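(* The solution of every algebraic equation constructed by three numbers functions of two variables can be represented as a superposition of three numbers functions of one variable. That is, let $A=\{-1,0,1\}$, and let $t_1(x,a_1,\dots,a_n)=t_2(x,a_1,\dots,a_n)$ be an equation with unknown $x$ and parameters $a_1,\dots,a_n$ ($n\ge1$) ranging over $A$, where $t_1,t_2$ are terms built from the variables $x,a_1,\dots,a_n$ by finitely many applications of binary three numbers functions. Then its solution function $W:A^n\to\mathcal{P}(A)$, which assigns to $(a_1,\dots,a_n)$ the set of all $x\in A$ satisfying the equation, is a superposition, in the variables $a_1,\dots,a_n$, of three numbers functions of one variable.
   Context: $A=\{-1,0,1\}$ is equipped with addition modulo $3$. A three numbers function of $M$ variables assigns to each point of $A^M$ a set of values in $A$ (one value, several values, or no value), i.e. it is a map $A^M\to\mathcal{P}(A)$, where $\mathcal{P}(A)$ is the power set; single-valued functions are identified with ordinary maps $A^M\to A$. Conventions for combining values: for $S,T\subseteq A$, $S+T=\{s+t:s\in S,\ t\in T\}$ (empty if either set is empty). For a unary function $f$, $f[S]=\bigcup_{s\in S}f(s)$. For a binary function $\psi$, $\psi(S,T)=\bigcup_{s\in S,\,t\in T}\psi(s,t)$. Sums and compositions of functions are pointwise with these conventions. Terms: each variable is a term, and if $t,t'$ are terms and $\psi$ is a binary three numbers function then $\psi(t,t')$ is a term. The equation $t_1=t_2$ is satisfied at given values of the variables if the value sets of $t_1$ and $t_2$ there have a common element (for single-valued functions this is ordinary equality; if $t_2$ is a parameter $c$, it means that $c$ is one of the values of $t_1$). A typical equation is $\psi_3\big(\psi_1(x,a),\psi_2(x,b)\big)=c$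 with unknown $x$ and parameters $a,b,c$. The solution function may be single-valued, many-valued or no-valued at a given point. Superpositions of functions of one variable, in variables $a_1,\dots,a_n$, are the functions $A^n\to\mathcal{P}(A)$ obtained by finitely many applications of the following rules: (i) $(a_1,\dots,a_n)\mapsto g(a_j)$ is a superposition for every unary $g:A\to\mathcal{P}(A)$ and every $j$; (ii) if $F,G$ are superpositions, so is $F+G$; (iii) if $F$ is a superposition and $f:A\to\mathcal{P}(A)$ is unary, then $f[F]$ is a superposition. *)

(* Defs.v *)
From HB Require Import structures.
From mathcomp Require Import all_boot all_order all_algebra.

Set Implicit Arguments.
Unset Strict Implicit.
Unset Printing Implicit Defensive.

Import GRing.Theory.
Local Open Scope ring_scope.

(* {-1, 0, 1} with addition modulo 3; the residue 2 of 'Z_3 is -1. *)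
Notation trit := 'Z_3.

(* Three numbers functions of one and of two variables, in curried form. *)
Definition tnf1 := trit -> {set trit}.
Definition tnf2 := trit -> trit -> {set trit}.

(* Finite functions, so that Leibniz equality is extensional and [superposition]
   below is a property of the function, not of the expression defining it. *)
Definition tnf (n : nat) := {ffun {ffun 'I_n -> trit} -> {set trit}}.

Definition set_add (S T : {set trit}) : {set trit} :=
  [set s + t | s in S, t in T].

Definition set_app1 (f : tnf1) (S : {set trit}) : {set trit} :=
  \bigcup_(s in S) f s.

Definition set_app2 (psi : tnf2) (S T : {set trit}) : {set trit} :=
  \bigcup_(s in S) \bigcup_(t in T) psi s t.

Inductive term (n : nat) : Type :=
| Unknown
| Param of 'I_n
| App of tnf2 & term n & term n.

Arguments Unknown {n}.

Fixpoint eval (n : nat) (x : trit) (a : {ffun 'I_n -> trit}) (t : term n)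
    : {set trit} :=
  match t with
  | Unknown => [set x]
  | Param i => [set a i]
  | App psi t1 t2 => set_app2 psi (eval x a t1) (eval x a t2)
  end.

Definition satisfies (n : nat) (t1 t2 : term n)
    (x : trit) (a : {ffun 'I_n -> trit}) : bool :=
  [exists v, (v \in eval x a t1) && (v \in eval x a t2)].

Definition solution (n : nat) (t1 t2 : term n) : tnf n :=
  [ffun a => [set x | satisfies t1 t2 x a]].

Inductive superposition (n : nat) : tnf n -> Prop :=
| superposition_var (g : tnf1) (j : 'I_n) :
    superposition [ffun a : {ffun 'I_n -> trit} => g (a j)]
| superposition_add (F G : tnf n) :
    superposition F -> superposition G ->
    superposition [ffun a : {ffun 'I_n -> trit} => set_add (F a) (G a)]
| superposition_app (f : tnf1) (F : tnf n) :
    superposition F ->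
    superposition [ffun a : {ffun 'I_n -> trit} => set_app1 f (F a)].

(* Main.v *)
(** Every function [A^n -> P(A)] is a superposition. Among single-valued
functions, multiplication is available because
[x y = x^2 + y^2 - (x + y)^2] modulo 3, so every map [A^n -> A] is one, by
Lagrange interpolation. A nonempty subset of [A] is the Minkowski sum of a point
and one of [{0}], [{0,1}], [A], and adding the empty set makes a value empty;
so an arbitrary function is a single-valued one plus two unary functions
applied to single-valued ones. *)

Require Import Defs.
From mathcomp Require Import all_boot all_order all_algebra.

Set Implicit Arguments.
Unset Strict Implicit.
Unset Printing Implicit Defensive.

Import GRing.Theory.
Local Open Scope ring_scope.

Lemma set_add_set1 (x y : trit) : set_add [set x] [set y] = [set x + y].
Proof. by rewrite /set_add imset2_set1l imset_set1. Qed.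

Lemma set_app1_set1 (f : tnf1) (x : trit) : set_app1 f [set x] = f x.
Proof. by rewrite /set_app1 big_set1. Qed.

Lemma mem_set_add1 (x y : trit) (T : {set trit}) :
  (y \in set_add [set x] T) = (y - x \in T).
Proof.
apply/imset2P/idP => [[_ t /set1P -> tT ->]|yxT].
  by rewrite addrC addKr.
by exists x (y - x); rewrite ?set11 // addrC subrK.
Qed.

Lemma set_addr_set0 (T : {set trit}) : set_add T set0 = set0.
Proof. by apply/setP=> y; rewrite inE; apply/imset2P => -[s t _]; rewrite inE. Qed.

Lemma set_addr_0 (T : {set trit}) : set_add T [set 0] = T.
Proof.
apply/setP=> y; apply/imset2P/idP => [[s _ sT /set1P -> ->]|yT].
  by rewrite addr0.
by exists y 0; rewrite ?set11 ?addr0.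
Qed.

Section SingleValued.
Variable n : nat.
Implicit Types phi psi : {ffun 'I_n -> trit} -> trit.

Definition single_superposition phi : Prop :=
  superposition [ffun a => [set phi a]].

Lemma single_ext phi psi :
  phi =1 psi -> single_superposition phi -> single_superposition psi.
Proof.
rewrite /single_superposition => eq_phi.
by under eq_ffun do rewrite eq_phi.
Qed.

Lemma superposition_app_single (f : tnf1) phi :
  single_superposition phi -> superposition [ffun a => f (phi a)].
Proof.
move=> /(superposition_app f); congr superposition.
by apply/ffunP=> a; rewrite !ffunE set_app1_set1.
Qed.

Lemma single_var (g : trit -> trit) (j : 'I_n) :
  single_superposition (fun a => g (a j)).
Proof. exact: (superposition_var (fun x => [set g x])). Qed.

Lemma single_app (g : trit -> trit) phi :
  single_superposition phi -> single_superposition (fun a => g (phi a)).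
Proof. exact: (superposition_app_single (fun x => [set g x])). Qed.

Lemma single_add phi psi :
  single_superposition phi -> single_superposition psi ->
  single_superposition (fun a => phi a + psi a).
Proof.
move=> sphi spsi; move: (superposition_add sphi spsi); congr superposition.
by apply/ffunP=> a; rewrite !ffunE set_add_set1.
Qed.

(** Since -2 = 1 modulo 3, the cross term of the negated square is exactly [x * y]. *)
Lemma trit_mulE (x y : trit) : x * y = x ^+ 2 + y ^+ 2 + - (x + y) ^+ 2.
Proof.
by apply/eqP; move: x y; do 2!case=> [[|[|[|//]]] ?].
Qed.

Lemma single_mul phi psi :
  single_superposition phi -> single_superposition psi ->
  single_superposition (fun a => phi a * psi a).
Proof.
move=> sphi spsi.
apply: (single_ext (fun a => esym (trit_mulE (phi a) (psi a)))).
apply: single_add.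
  by apply: single_add; apply: (single_app (fun x => x ^+ 2)).
(* The rules offer no subtraction, so the minus sign is absorbed into the unary function. *)
by apply: (single_app (fun x => - x ^+ 2)); apply: single_add.
Qed.

Hypothesis n_gt0 : (0 < n)%N.

(** A constant enters as a constant unary function of some variable, hence the need for [0 < n]. *)
Lemma single_const (c : trit) : single_superposition (fun=> c).
Proof. exact: (single_var (fun=> c) (Ordinal n_gt0)). Qed.

Lemma single_sum (I : Type) (r : seq I) (F : I -> {ffun 'I_n -> trit} -> trit) :
  (forall i, single_superposition (F i)) ->
  single_superposition (fun a => \sum_(i <- r) F i a).
Proof.
move=> sF; elim: r => [|i r IHr].
  by apply: single_ext (single_const 0) => a; rewrite big_nil.
by apply: single_ext (single_add (sF i) IHr) => a; rewrite big_cons.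
Qed.

Lemma single_prod (I : Type) (r : seq I) (F : I -> {ffun 'I_n -> trit} -> trit) :
  (forall i, single_superposition (F i)) ->
  single_superposition (fun a => \prod_(i <- r) F i a).
Proof.
move=> sF; elim: r => [|i r IHr].
  by apply: single_ext (single_const 1) => a; rewrite big_nil.
by apply: single_ext (single_mul (sF i) IHr) => a; rewrite big_cons.
Qed.

(** The product is the indicator of [a = b], split into factors that each depend on one coordinate
    of [a]. *)
Lemma lagrange_interpolation phi (a : {ffun 'I_n -> trit}) :
  \sum_b phi b * \prod_i (a i == b i)%:R = phi a.
Proof.
rewrite (bigD1 a) //= [X in _ + X]big1 => [|b neq_ba].
  by rewrite big1 ?mulr1 ?addr0 // => i _; rewrite eqxx.
have [i neq_i]: exists i, a i != b i.
  apply/existsP; rewrite -negb_forall; apply: contra neq_ba => /forallP eq_ab.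
  by apply/eqP/ffunP=> i; rewrite (eqP (eq_ab i)).
by rewrite (bigD1 i) //= (negPf neq_i) mul0r mulr0.
Qed.

Lemma single_superposition_all phi : single_superposition phi.
Proof.
apply: single_ext (lagrange_interpolation phi) _.
apply: single_sum => b; apply: single_mul; first exact: single_const.
by apply: single_prod => i; apply: (single_var (fun x => (x == b i)%:R)).
Qed.

End SingleValued.

(* For a nonempty [S], the start of the arc [S] of the cycle [Z/3]. *)
Definition base_point (S : {set trit}) : trit :=
  odflt 0 [pick x in S | x - 1 \notin S].

(* [y <= k] compares representatives in {0, 1, 2}, so [shape] gives {0}, {0,1}, [A]. *)
Definition shape (k : trit) : {set trit} := [set y : trit | (y <= k)%N].

(** The predecessor keeps sizes 1, 2, 3 distinct modulo 3, as 0, 1, 2. *)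
Definition shape_code (S : {set trit}) : trit := inZp #|S|.-1.

(** As a summand, [set0] is absorbing and [[set 0]] is neutral. *)
Definition guard (w : trit) : {set trit} := if w == 0 then set0 else [set 0].

Definition nonempty_code (S : {set trit}) : trit := (S != set0)%:R.

(** Case analysis that yields the literals [0], [1], [-1], matching the memberships counted in
    [card_trit]. *)
Lemma forall_trit (P : trit -> Prop) : P 0 -> P 1 -> P (-1) -> forall x, P x.
Proof.
move=> P0 P1 P2 [[|[|[|//]]] lti];
  [move: P0 | move: P1 | move: P2]; congr P; exact: val_inj.
Qed.

Lemma card_trit (S : {set trit}) :
  #|S| = ((0%R \in S) + (1%R \in S) + ((-1)%R \in S))%N.
Proof.
rewrite -sum1_card big_mkcond /= !big_ord_recl big_ord0 /=.
have -> : lift ord0 ord0 = 1 :> trit by apply: val_inj.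
have -> : lift ord0 (lift ord0 ord0) = -1 :> trit by apply: val_inj.
have -> : ord0 = 0 :> trit by apply: val_inj.
by do 3!case: (_ \in S).
Qed.

(** Every nonempty subset of the 3-cycle is an arc of consecutive points, hence a translate of the
    initial segment of the same size. *)
Lemma set_decomposition (S : {set trit}) :
  S = set_add (set_add [set base_point S] (shape (shape_code S)))
              (guard (nonempty_code S)).
Proof.
rewrite /guard /nonempty_code; have [->|S_n0] := eqVneq S set0.
  by rewrite eqxx set_addr_set0.
rewrite oner_eq0 set_addr_0; apply/setP=> y; rewrite mem_set_add1 inE.
rewrite /base_point /shape_code card_trit.
have sub01 : 0 - 1 = -1 :> trit by apply: val_inj.
have sub11 : 1 - 1 = 0 :> trit by apply: val_inj.
have subN11 : -1 - 1 = 1 :> trit by apply: val_inj.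
have S_mem: [|| 0 \in S, 1 \in S | -1 \in S].
  apply: contraNT S_n0; rewrite !negb_or => /and3P[n0 n1 n2].
  apply/eqP/setP; apply: forall_trit; rewrite inE; exact: negPf.
case: pickP => [x | nox] /=.
  elim/forall_trit: x; rewrite ?sub01 ?sub11 ?subN11; elim/forall_trit: y;
  by move: S_mem; do 3!case: (_ \in S).
(* No point starts an arc, so the nonempty [S] is closed under predecessor and equals the whole
   cycle; the default base point 0 then works, as would any other. *)
move: (nox 0) (nox 1) (nox (-1)); rewrite ?sub01 ?sub11 ?subN11.
by elim/forall_trit: y; move: S_mem; do 3!case: (_ \in S).
Qed.

Lemma superposition_all (n : nat) (n_gt0 : (0 < n)%N) (F : tnf n) :
  superposition F.
Proof.
(* Any single-valued code of [F a] is itself a map from [A^n] to [A], so interpolation covers it. *)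
have sphi (phi : {set trit} -> trit) :
    single_superposition (fun a => phi (F a)).
  exact: single_superposition_all.
move: (superposition_add
  (superposition_add (sphi base_point)
    (superposition_app_single shape (sphi shape_code)))
  (superposition_app_single guard (sphi nonempty_code))).
congr superposition.
by apply/ffunP=> a; rewrite !ffunE -set_decomposition.
Qed.

Theorem theorem3p1 (n : nat) (hn : (0 < n)%N) (t1 t2 : term n) :
  superposition (solution t1 t2).
Proof. exact: superposition_all. Qed.
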